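(* Let $\mathcal A$ and $\mathcal B$ be two commutative semisimple Fréchet algebras. Then $$\mathrm M(\mathcal A\oplus\mathcal B)=\mathrm M(\mathcal A)\oplus\mathrm M(\mathcal B),$$ where a pair $(S,T)\in\mathrm M(\mathcal A)\oplus\mathrm M(\mathcal B)$ is identified with the operator $(a,b)\mapsto(S(a),T(b))$ on $\mathcal A\oplus\mathcal B$.
   Context: A Fréchet algebra is a complete metrizable (Hausdorff) topological algebra over $\mathbb C$ whose topology is generated by a countable increasing family of submultiplicative seminorms. For a commutative Fréchet algebra $\mathcal C$, $\Delta(\mathcal C)$ is the set of all nonzero continuous multiplicative linear functionals $\mathcal C\to\mathbb C$. $\mathcal C$ is semisimple if $\bigcap_{\varphi\in\Delta(\mathcal C)}\ker\varphi=\{0\}$ (equivalently, zero Jacobson radical). A linear operator $T:\mathcal C\to\mathcal C$ is a multiplier if $aT(b)=T(ab)$ for all $a,b\in\mathcal C$; $\mathrm M(\mathcal C)$ is the algebra of all multipliers of $\mathcal C$. Direct sum: if the topologies of $\mathcal A,\mathcal B$ are given by increasing submultiplicative seminorms $(r_\ell)_{\ell\in\mathbb N}$, $(s_\ell)_{\ell\in\mathbb N}$, then $\mathcal A\oplus\mathcal B=\mathcal A\times\mathcal B$ with coordinatewise linear operations and multiplication, and seminorms $P_\ell(a,b)=r_\ell(a)+s_\ell(b)$; this is a commutative Fréchet algebra. *)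

(* Defs.v *)
From HB Require Import structures.
From mathcomp Require Import all_boot all_order all_algebra.
From mathcomp Require Import complex.
From mathcomp Require Import all_classical all_reals all_analysis.

Set Implicit Arguments.
Unset Strict Implicit.
Unset Printing Implicit Defensive.

Import Order.TTheory GRing.Theory Num.Theory.

Local Open Scope classical_set_scope.
Local Open Scope ring_scope.

(* Associative algebras without a unit requirement; MathComp's [algType] is
   unital and nontrivial. *)
HB.mixin Record Lmodule_isAssocAlgebra (K : pzRingType) A
    & GRing.Lmodule K A := {
  amul : A -> A -> A ;
  amulA : associative amul ;
  amulDl : forall x y z, amul (x + y) z = amul x z + amul y z ;
  amulDr : forall x y z, amul x (y + z) = amul x y + amul x z ;
  amulZl : forall (k : K) x y, amul (k *: x) y = k *: amul x y ;
  amulZr : forall (k : K) x y, amul x (k *: y) = k *: amul x y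
}.

#[short(type="assocAlgType")]
HB.structure Definition AssocAlgebra (K : pzRingType) :=
  {A of Lmodule_isAssocAlgebra K A & GRing.Lmodule K A}.

Notation "x ⋅ y" := (amul x y) (at level 40, left associativity) : ring_scope.

Section assoc_algebra_prod.
Context (K : pzRingType) (A B : assocAlgType K).

Let mulp (x y : A * B) : A * B := (x.1 ⋅ y.1, x.2 ⋅ y.2).

Let mulpA : associative mulp.
Proof. by move=> x y z; rewrite /mulp /= !amulA. Qed.

Let mulpDl x y z : mulp (x + y) z = mulp x z + mulp y z.
Proof. by rewrite /mulp /= !amulDl. Qed.

Let mulpDr x y z : mulp x (y + z) = mulp x y + mulp x z.
Proof. by rewrite /mulp /= !amulDr. Qed.

Let mulpZl (k : K) x y : mulp (k *: x) y = k *: mulp x y.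
Proof. by rewrite /mulp /= !amulZl. Qed.

Let mulpZr (k : K) x y : mulp x (k *: y) = k *: mulp x y.
Proof. by rewrite /mulp /= !amulZr. Qed.

HB.instance Definition _ := Lmodule_isAssocAlgebra.Build K (A * B)%type
  mulpA mulpDl mulpDr mulpZl mulpZr.

End assoc_algebra_prod.

Definition seminorm (R : realType) (V : lmodType R[i]) (p : V -> R) :=
  [/\ forall x, 0 <= p x,
      forall x y, p (x + y) <= p x + p y
    & forall (k : R[i]) x, p (k *: x) = Normc.normc k * p x].

Definition submultiplicative (R : realType) (A : assocAlgType R[i])
  (p : A -> R) := forall x y, p (x ⋅ y) <= p x * p y.

(* The seminorms are required to generate the uniform structure, not only the
   topology: a [tvsType] does not tie its uniformity to its addition, and
   completeness is completeness for the uniformity. For an increasing family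
   [p], the sets [p n (x - y) < e] do form a base of entourages. *)
Definition generated_by (R : realType) (A : tvsType R[i]) (p : nat -> A -> R) :=
  forall E : set (A * A), entourage E <->
    exists n, exists2 e : R, 0 < e & forall x y, p n (x - y) < e -> E (x, y).

(* Metrizability is a consequence: a countable family of seminorms yields a
   countable base of entourages.  Completeness is the axiom of [completeType],
   stated as a field because [Complete] has no join with [Tvs]. *)
HB.mixin Record isFrechetAlgebra (R : realType) A
    & Tvs R[i] A & AssocAlgebra R[i] A := {
  amul_continuous : continuous (fun z : A * A => z.1 ⋅ z.2) ;
  frechet_hausdorff : hausdorff_space A ;
  frechet_complete : forall F : set_system A,
    ProperFilter F -> cauchy F -> exists x : A, F --> x ;
  frechet_seminorms : exists p : nat -> A -> R,
    [/\ forall n, seminorm (p n),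
        forall n x, p n x <= p n.+1 x,
        forall n, submultiplicative (p n)
      & generated_by p]
}.

#[short(type="frechetAlgType")]
HB.structure Definition FrechetAlgebra (R : realType) :=
  {A of isFrechetAlgebra R A & Tvs R[i] A & AssocAlgebra R[i] A}.

Section frechet_prod.
Context (R : realType) (A B : frechetAlgType R).

Let prod_mul_continuous :
  continuous (fun z : (A * B) * (A * B) => z.1 ⋅ z.2).
Proof.
move=> [/= xy1 xy2] /= U /= [] [P Q] /= [nP nQ] nU.
have [/= P0 [P01 P02] nP1] := @amul_continuous R A (xy1.1, xy2.1) _ nP.
have [/= Q0 [Q01 Q02] nQ1] := @amul_continuous R B (xy1.2, xy2.2) _ nQ.
exists ([set xy | P0.1 xy.1 /\ Q0.1 xy.2], [set xy | P0.2 xy.1 /\ Q0.2 xy.2]).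
  by split; [exists (P0.1, Q0.1)|exists (P0.2, Q0.2)].
move => [[x1 y1][x2 y2]] /= [] [] a1 b1 [] a2 b2.
by apply: nU; split; [exact: (nP1 (x1, x2))|exact: (nQ1 (y1, y2))].
Qed.

Let prod_hausdorff : hausdorff_space (A * B)%type.
Proof.
move=> [a b] [c d] cl; congr pair.
  apply: (@frechet_hausdorff R A) => P Q aP cQ.
  have nP : nbhs (a, b) (fst @^-1` P) by exact: cvg_fst aP.
  have nQ : nbhs (c, d) (fst @^-1` Q) by exact: cvg_fst cQ.
  by have [[z w] [/= Pz Qz]] := cl _ _ nP nQ; exists z.
apply: (@frechet_hausdorff R B) => P Q bP dQ.
have nP : nbhs (a, b) (snd @^-1` P) by exact: cvg_snd bP.
have nQ : nbhs (c, d) (snd @^-1` Q) by exact: cvg_snd dQ.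
by have [[z w] [/= Pz Qz]] := cl _ _ nP nQ; exists w.
Qed.

Let prod_complete (F : set_system (A * B)) :
  ProperFilter F -> cauchy F -> exists x : A * B, F --> x.
Proof.
move=> FF Fc.
have c1 : cauchy (fst @ F).
  move=> E entE.
  have /Fc[[P Q] /= [FP FQ] PQ] :
      entourage [set z : (A * B) * (A * B) | E (z.1.1, z.2.1)].
    exists (E, setT) => /=; first by split=> //; exact: entourageT.
    by move=> [[a b] [c d]] /= [] ? _; exists ((a, c), (b, d)).
  exists (fst @` P, fst @` Q) => /=.
    by split; [apply: filterS FP|apply: filterS FQ] => z Pz; exists z.
  by move=> [x y] /= [[z Pz <-] [w Qw <-]]; exact: (PQ (z, w)).
have c2 : cauchy (snd @ F).
  move=> E entE.
  have /Fc[[P Q] /= [FP FQ] PQ] :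
      entourage [set z : (A * B) * (A * B) | E (z.1.2, z.2.2)].
    exists (setT, E) => /=; first by split=> //; exact: entourageT.
    by move=> [[a b] [c d]] /= [] _ ?; exists ((a, c), (b, d)).
  exists (snd @` P, snd @` Q) => /=.
    by split; [apply: filterS FP|apply: filterS FQ] => z Pz; exists z.
  by move=> [x y] /= [[z Pz <-] [w Qw <-]]; exact: (PQ (z, w)).
have [a Fa] := @frechet_complete R A (fst @ F) _ c1.
have [b Fb] := @frechet_complete R B (snd @ F) _ c2.
exists (a, b) => P [[P1 P2] /= [aP1 bP2] PP].
have F1 : F (fst @^-1` P1) := Fa _ aP1.
have F2 : F (snd @^-1` P2) := Fb _ bP2.
exact: (@filterS _ F _ _ _ PP (filterI F1 F2)).
Qed.

Lemma dsum_seminorms (r : nat -> A -> R) (s : nat -> B -> R) :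
  [/\ forall n, seminorm (r n), forall n x, r n x <= r n.+1 x,
      forall n, submultiplicative (r n) & generated_by r] ->
  [/\ forall n, seminorm (s n), forall n x, s n x <= s n.+1 x,
      forall n, submultiplicative (s n) & generated_by s] ->
  let P n (z : A * B) := r n z.1 + s n z.2 in
  [/\ forall n, seminorm (P n), forall n x, P n x <= P n.+1 x,
      forall n, submultiplicative (P n) & generated_by P].
Proof.
move=> [r_semi r_incr r_subm r_gen] [s_semi s_incr s_subm s_gen] P.
have r0 n x : 0 <= r n x by case: (r_semi n).
have s0 n x : 0 <= s n x by case: (s_semi n).
split.
- move=> n; have [_ rD rZ] := r_semi n; have [_ sD sZ] := s_semi n.
  split=> [x|x y|k x]; rewrite /P.
  + exact: addr_ge0.
  + by rewrite addrACA; apply: lerD; [exact: rD|exact: sD].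
  + by rewrite /= rZ sZ mulrDr.
- by move=> n x; apply: lerD; [exact: r_incr|exact: s_incr].
- move=> n x y; rewrite /P /=.
  apply: (le_trans (lerD (r_subm n _ _) (s_subm n _ _))).
  rewrite mulrDl !mulrDr -addrA lerD2l addrA lerDr.
  by rewrite addr_ge0 ?mulr_ge0.
move=> E; split; last first.
  move=> [n [e e0 PE]].
  exists ([set z | r n (z.1 - z.2) < e / 2], [set z | s n (z.1 - z.2) < e / 2]).
    split; [apply/r_gen|apply/s_gen]; exists n, (e / 2) => //;
      by rewrite divr_gt0.
  move=> [[a b] [c d]] /= [rn sn]; exists ((a, c), (b, d)) => //.
  by apply: PE; rewrite /P /= [ltRHS]splitr ltrD.
move=> [[E1 E2] /= [/r_gen[n1 [e1 e10 nE1]] /s_gen[n2 [e2 e20 nE2]]] EE].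
exists (maxn n1 n2), (Num.min e1 e2); first by rewrite lt_min e10 e20.
move=> [a c] [b d]; rewrite /P /= => le.
have rle : r n1 (a - b) <= r (maxn n1 n2) (a - b).
  exact: (homo_leq (lexx : reflexive (fun x y : R => x <= y)) le_trans
    (r_incr ^~ (a - b)) (leq_maxl _ _)).
have sle : s n2 (c - d) <= s (maxn n1 n2) (c - d).
  exact: (homo_leq (lexx : reflexive (fun x y : R => x <= y)) le_trans
    (s_incr ^~ (c - d)) (leq_maxr _ _)).
have [|[[x y] [z w]] /= Ez [<- <- <- <-]//] := EE ((a, b), (c, d)).
split=> /=; [apply: nE1; apply: le_lt_trans rle _
            |apply: nE2; apply: le_lt_trans sle _];
  move: le; rewrite lt_min => /andP[l1 l2].
  by apply: le_lt_trans l1; rewrite lerDl.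
by apply: le_lt_trans l2; rewrite lerDr.
Qed.

Let prod_seminorms : exists p : nat -> A * B -> R,
  [/\ forall n, seminorm (p n), forall n x, p n x <= p n.+1 x,
      forall n, submultiplicative (p n) & generated_by p].
Proof.
have [r Hr] := @frechet_seminorms R A; have [s Hs] := @frechet_seminorms R B.
by eexists; exact: dsum_seminorms Hr Hs.
Qed.

HB.instance Definition _ := isFrechetAlgebra.Build R (A * B)%type
  prod_mul_continuous prod_hausdorff prod_complete prod_seminorms.

End frechet_prod.

Section spectrum.
Context (R : realType) (A : frechetAlgType R).

Definition spectrum : set {linear A -> R[i]^o} :=
  [set phi : {linear A -> R[i]^o} |
              [/\ continuous phi,
                 forall x y, phi (x ⋅ y) = phi x * phi y
               & exists x, phi x != 0]].

Definition semisimple : Prop :=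
  \bigcap_(phi in spectrum) [set x : A | phi x = 0] = [set 0].

End spectrum.
Arguments semisimple {R} A.

Definition is_multiplier (K : pzRingType) (A : assocAlgType K) (T : A -> A) :=
  linear T /\ forall a b, a ⋅ T b = T (a ⋅ b).

Section multiplier_algebra.
Context (K : comPzRingType) (A : assocAlgType K).

Definition multiplier_pred : {pred A -> A} := fun T => `[< is_multiplier T >].

Record multiplier := Multiplier {
  multiplier_fun :> A -> A ;
  _ : multiplier_fun \in multiplier_pred }.

HB.instance Definition _ := [isSub for multiplier_fun].
HB.instance Definition _ := [Choice of multiplier by <:].

Lemma multiplierP (T : multiplier) : is_multiplier T.
Proof. by case: T => f Tf; apply/asboolP. Qed.

Let pred_submod : submod_closed multiplier_pred.
Proof.
split.
  apply/asboolP; split=> [k x y|a b] /=; first by rewrite scaler0 addr0.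
  by rewrite -(scale0r 0) amulZr !scale0r.
move=> k S T /asboolP[Sl Sm] /asboolP[Tl Tm]; apply/asboolP; split.
  move=> l x y; have kE z : (k *: S + T) z = k *: S z + T z by [].
  by rewrite !kE Sl Tl !scalerDr !scalerA mulrC addrACA.
move=> a b; have kE z : (k *: S + T) z = k *: S z + T z by [].
by rewrite !kE -Sm -Tm -amulZr -amulDr.
Qed.

HB.instance Definition _ :=
  GRing.isSubmodClosed.Build K (A -> A) multiplier_pred pred_submod.
HB.instance Definition _ := [SubChoice_isSubLmodule of multiplier by <:].

Lemma multiplier_id_subproof : (idfun : A -> A) \in multiplier_pred.
Proof. by apply/asboolP; split=> [k x y|a b]. Qed.

Lemma multiplier_comp_subproof (S T : multiplier) :
  ((S : A -> A) \o T) \in multiplier_pred.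
Proof.
have [Sl Sm] := multiplierP S; have [Tl Tm] := multiplierP T.
apply/asboolP; split=> [k x y|a b] /=; first by rewrite Tl Sl.
by rewrite Sm Tm.
Qed.

Definition multiplier_one := Multiplier multiplier_id_subproof.
Definition multiplier_comp S T := Multiplier (multiplier_comp_subproof S T).

Let multiplier_eq (S T : multiplier) : S =1 T -> S = T.
Proof. by move=> ST; apply: val_inj; apply/funext. Qed.

Let compA : associative multiplier_comp.
Proof. by move=> S T U; exact: multiplier_eq. Qed.
Let comp1l : left_id multiplier_one multiplier_comp.
Proof. by move=> S; exact: multiplier_eq. Qed.
Let comp1r : right_id multiplier_one multiplier_comp.
Proof. by move=> S; exact: multiplier_eq. Qed.
Let compDl : left_distributive multiplier_comp +%R.
Proof. by move=> S T U; exact: multiplier_eq. Qed.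
Let compDr : right_distributive multiplier_comp +%R.
Proof.
move=> S T U; apply: multiplier_eq => x /=.
have [Sl _] := multiplierP S.
by have := Sl 1 (T x) (U x); rewrite !scale1r.
Qed.

(* [M(A)] is only a [pzRingType]: it is the zero ring when [A] is zero. *)
HB.instance Definition _ := GRing.Zmodule_isPzRing.Build multiplier
  compA comp1l comp1r compDl compDr.

Lemma multiplier_scalerAl (k : K) (S T : multiplier) :
  k *: (S * T) = (k *: S) * T.
Proof. exact: multiplier_eq. Qed.

Lemma multiplier_scalerAr (k : K) (S T : multiplier) :
  k *: (S * T) = S * (k *: T).
Proof.
apply: multiplier_eq => x; have [Sl _] := multiplierP S.
have S0 : S 0 = 0.
  by have := Sl (-1) 0 0; rewrite scaleN1r oppr0 addr0 scaleN1r addNr.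
by have := Sl k (T x) 0; rewrite S0 !addr0 => /esym.
Qed.

End multiplier_algebra.

(* Main.v *)
(* A semisimple algebra has no nonzero x with y x = 0 for all y, since every
   character phi takes a nonzero value at some y and phi(y) phi(x) = 0. For a
   multiplier U of the direct sum, (0, y) U(a, 0) = U((0, y) (a, 0)) = 0, so
   U(a, 0) has zero second component, and symmetrically U(0, b) has zero first
   component; hence U is the pair of its two diagonal components. *)

Require Import Defs.
From HB Require Import structures.
From mathcomp Require Import all_boot all_order all_algebra.
From mathcomp Require Import complex.
From mathcomp Require Import all_classical all_reals all_analysis.

Set Implicit Arguments.
Unset Strict Implicit.
Unset Printing Implicit Defensive.

Import GRing.Theory.

Local Open Scope ring_scope.

(** Vanishing of the annihilator $\{x : Ax = 0\}$. Semisimplicity enters the direct sum argument in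
    this purely algebraic form. *)
Definition faithful_algebra (K : pzRingType) (A : assocAlgType K) :=
  forall x : A, (forall y, y ⋅ x = 0) -> x = 0.

Lemma semisimple_faithful (R : realType) (A : frechetAlgType R) :
  semisimple A -> faithful_algebra A.
Proof.
move=> ssA x yx0; suff: [set 0]%classic x by [].
(* Membership in [[set 0]] becomes membership in the kernel of each character. *)
rewrite -ssA => phi [_ phiM [y phiy0]] /=.
have /eqP : phi y * phi x = 0 by rewrite -phiM yx0 linear0.
by rewrite mulf_eq0 (negPf phiy0) => /eqP.
Qed.

Section multiplier_basics.
Context (K : comPzRingType) (A : assocAlgType K).
Implicit Type T : multiplier A.

Lemma amul0r (x : A) : 0 ⋅ x = 0.
Proof. by rewrite -(scale0r 0) amulZl !scale0r. Qed.

Lemma amulr0 (x : A) : x ⋅ 0 = 0.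
Proof. by rewrite -(scale0r 0) amulZr !scale0r. Qed.

Lemma multiplier_ext (S T : multiplier A) : S =1 T -> S = T.
Proof. by move=> ST; apply: val_inj; exact/boolp.funext. Qed.

Lemma multiplier_linear T : linear T. Proof. by case: (multiplierP T). Qed.

Lemma multiplierM T a b : a ⋅ T b = T (a ⋅ b).
Proof. by case: (multiplierP T). Qed.

Lemma multiplierD T x y : T (x + y) = T x + T y.
Proof. by have := multiplier_linear T 1 x y; rewrite !scale1r. Qed.

Lemma multiplier0 T : T 0 = 0.
Proof. by apply: (@addrI _ (T 0)); rewrite -multiplierD !addr0. Qed.

End multiplier_basics.

Section multiplier_direct_sum.
Context (K : comPzRingType) (A B : assocAlgType K).

Lemma multiplier_pair_subproof (S : multiplier A) (T : multiplier B) :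
  (fun z : A * B => (S z.1, T z.2)) \in @multiplier_pred K (A * B)%type.
Proof.
apply/asboolP; split=> [k x y|x y]; congr pair;
  by [exact: multiplier_linear | exact: multiplierM].
Qed.

(** Uncurried, so that the product ring is its domain and it can carry the morphism structures. *)
Definition multiplier_pair (ST : multiplier A * multiplier B) :
    multiplier (A * B)%type :=
  Multiplier (multiplier_pair_subproof ST.1 ST.2).

Lemma multiplier_pair_is_zmod_morphism : zmod_morphism multiplier_pair.
Proof. by move=> ST ST'; exact: multiplier_ext. Qed.

Lemma multiplier_pair_is_monoid_morphism : monoid_morphism multiplier_pair.
Proof.
(* Destructing the argument settles the unit law, which compares [(z.1, z.2)] with [z]. *)
by split=> [|ST ST']; apply: multiplier_ext => -[].
Qed.

HB.instance Definition _ := GRing.isZmodMorphism.Build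
  (multiplier A * multiplier B)%type (multiplier (A * B)%type)
  multiplier_pair multiplier_pair_is_zmod_morphism.
HB.instance Definition _ := GRing.isMonoidMorphism.Build
  (multiplier A * multiplier B)%type (multiplier (A * B)%type)
  multiplier_pair multiplier_pair_is_monoid_morphism.

Lemma multiplier_pair_scalable : scalable multiplier_pair.
Proof. by move=> k ST; exact: multiplier_ext. Qed.

Hypotheses (faithA : faithful_algebra A) (faithB : faithful_algebra B).
Implicit Type U : multiplier (A * B)%type.

Lemma multiplier_inl_snd U a : (U (a, 0)).2 = 0.
Proof.
apply: faithB => y.
have -> : y ⋅ (U (a, 0)).2 = ((0, y) ⋅ U (a, 0)).2 by [].
rewrite multiplierM (_ : (0, y) ⋅ (a, 0) = 0) ?multiplier0 //.
by congr pair; [exact: amul0r | exact: amulr0].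
Qed.

Lemma multiplier_inr_fst U b : (U (0, b)).1 = 0.
Proof.
apply: faithA => x.
have -> : x ⋅ (U (0, b)).1 = ((x, 0) ⋅ U (0, b)).1 by [].
rewrite multiplierM (_ : (x, 0) ⋅ (0, b) = 0) ?multiplier0 //.
by congr pair; [exact: amulr0 | exact: amul0r].
Qed.

(** In the $2 \times 2$ block form of [U], the two off-diagonal blocks vanish by the preceding
    lemmas. *)
Lemma multiplier_dsumE U a b : U (a, b) = ((U (a, 0)).1, (U (0, b)).2).
Proof.
have -> : (a, b) = (a, 0) + (0, b) by congr pair; rewrite /= ?addr0 ?add0r.
rewrite multiplierD; congr pair => /=.
  by rewrite multiplier_inr_fst addr0.
by rewrite multiplier_inl_snd add0r.
Qed.

(** The diagonal block of [U] on [A]: both the embedding [a |-> (a, 0)] and the first projection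
    respect linear combinations and products, so the multiplier laws carry over. *)
Lemma multiplier_restr1_subproof U :
  (fun a => (U (a, 0)).1) \in @multiplier_pred K A.
Proof.
apply/asboolP; split=> [k x y|x y].
  have -> : (k *: x + y, 0) = k *: (x, 0) + (y, 0) :> A * B.
    by congr pair; rewrite /= scaler0 addr0.
  by rewrite multiplier_linear.
have -> : (x ⋅ y, 0) = (x, 0) ⋅ (y, 0) :> A * B.
  by congr pair; rewrite /= amulr0.
by rewrite -multiplierM.
Qed.

Lemma multiplier_restr2_subproof U :
  (fun b => (U (0, b)).2) \in @multiplier_pred K B.
Proof.
apply/asboolP; split=> [k x y|x y].
  have -> : (0, k *: x + y) = k *: (0, x) + (0, y) :> A * B.
    by congr pair; rewrite /= scaler0 addr0.
  by rewrite multiplier_linear.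
have -> : (0, x ⋅ y) = (0, x) ⋅ (0, y) :> A * B.
  by congr pair; rewrite /= amulr0.
by rewrite -multiplierM.
Qed.

Lemma multiplier_pair_bij : bijective multiplier_pair.
Proof.
exists (fun U => (Multiplier (multiplier_restr1_subproof U),
                  Multiplier (multiplier_restr2_subproof U))).
  (* The diagonal blocks of a pair are its entries by computation. Faithfulness enters in the other
     cancellation, where [U] must be recovered from its diagonal blocks. *)
  by move=> [S T]; congr pair; exact: multiplier_ext.
by move=> U; apply: multiplier_ext => -[a b]; rewrite [RHS]multiplier_dsumE.
Qed.

End multiplier_direct_sum.

Theorem corollary2p4 (R : realType) (A B : frechetAlgType R)
    (comA : forall x y : A, x ⋅ y = y ⋅ x)
    (comB : forall x y : B, x ⋅ y = y ⋅ x)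
    (ssA : semisimple A) (ssB : semisimple B) :
  exists Phi : {rmorphism (multiplier A * multiplier B)%type ->
                          multiplier (A * B)%type},
    [/\ forall (S : multiplier A) (T : multiplier B) (a : A) (b : B),
          Phi (S, T) (a, b) = (S a, T b),
        scalable Phi
      & bijective Phi].
Proof.
exists (@multiplier_pair R[i] A B); split=> //.
- exact: multiplier_pair_scalable.
- exact: multiplier_pair_bij (semisimple_faithful ssA) (semisimple_faithful ssB).
Qed.
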